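(* For every coarse proximity space $(X,\mathcal{B},\mathbf{b})$ one has $Ind(\mathcal{U}X)\leq asInd(X)$.
   Context: Coarse proximity spaces. A bornology on a set $X$ is a family $\mathcal{B}$ of subsets of $X$ that contains all singletons, is closed under taking subsets, and is closed under unions of two members. Members of $\mathcal{B}$ are called bounded; other subsets of $X$ are unbounded. A coarse proximity space is a triple $(X,\mathcal{B},\mathbf{b})$ where $\mathcal{B}$ is a bornology on $X$ and $\mathbf{b}$ is a relation on the power set of $X$ such that for all $A,B,C\subseteq X$ (writing $\bar{\mathbf{b}}$ for the negation of $\mathbf{b}$): (1) $A\mathbf{b}B\Rightarrow B\mathbf{b}A$; (2) $A\mathbf{b}B\Rightarrow A,B\notin\mathcal{B}$; (3) $A\cap B\notin\mathcal{B}\Rightarrow A\mathbf{b}B$; (4) $(A\cup B)\mathbf{b}C\iff A\mathbf{b}C$ or $B\mathbf{b}C$; (5) $A\bar{\mathbf{b}}B\Rightarrow$ there is $E\subseteq X$ with $A\bar{\mathbf{b}}E$ and $(X\setminus E)\bar{\mathbf{b}}B$. A subset $Y\subseteq X$ carries the subspace coarse proximity structure: bornology $\{B\cap Y: B\in\mathcal{B}\}$, and $A\mathbf{b}_YC\iff A\mathbf{b}C$ for $A,C\subseteq Y$. Boundary. The discrete extension of $\mathbf{b}$ is the separated proximity $\delta$ on $X$ given by $A\delta B\iff(A\cap B\neq\emptyset$ or $A\mathbf{b}B)$. A cluster of $(X,\delta)$ is a collection $\sigma$ of nonempty subsets of $X$ such that $A\delta B$ for all $A,B\in\sigma$; if $C\delta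 A$ for all $A\in\sigma$ then $C\in\sigma$; and if $A\cup B\in\sigma$ then $A\in\sigma$ or $B\in\sigma$. The Smirnov compactification $\mathfrak{X}$ is the set of all clusters with the separated proximity $\delta^*$: $\mathcal{A}\delta^*\mathcal{C}$ iff $A\delta C$ for all $A,C\subseteq X$ such that $A\in\sigma$ for every $\sigma\in\mathcal{A}$ and $C\in\sigma$ for every $\sigma\in\mathcal{C}$. Its topology (closure of $\mathcal{A}$ is $\{\sigma:\{\sigma\}\delta^*\mathcal{A}\}$) is compact Hausdorff, and $X$ is identified with the dense set of point clusters (those containing a singleton); then $cl_{\mathfrak{X}}(A)=\{\sigma\in\mathfrak{X}:A\in\sigma\}$ for $A\subseteq X$. The boundary $\mathcal{U}X\subseteq\mathfrak{X}$ is the subspace of clusters containing no bounded set (it is compact Hausdorff). The trace of $A\subseteq X$ is $A'=cl_{\mathfrak{X}}(A)\cap\mathcal{U}X$. Dimensions. A separator between disjoint subsets $A,B$ of a topological space $T$ is a set $C\subseteq T$ such that $T\setminus C=U\cup V$ with $U,V$ disjoint open in $T$, $A\subseteq U$, $B\subseteq V$. The large inductive dimension of a normal space $T$: $Ind(T)=-1$ iff $T=\emptyset$; for $n\ge 0$, $Ind(T)\le n$ if for every pair of disjoint closed $A,B\subseteq T$ there is a separator $C$ between them with $Ind(C)\le n-1$; $Ind(T)=n$ if $n\ge -1$ is the smallest integer with $Ind(T)\le n$; $Ind(T)=\infty$ if there is no such integer. If $A\bar{\mathbf{b}}B$ in $X$, an asymptotic separator between $A$ and $B$ is a set $C\subseteq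 X$ such that $C'$ is a separator in $\mathcal{U}X$ between $A'$ and $B'$. The asymptotic inductive dimension: $asInd(X)=-1$ iff $X$ is bounded; for $n\ge0$, $asInd(X)\le n$ if for all $A,B\subseteq X$ with $A\bar{\mathbf{b}}B$ there is an asymptotic separator $C\subseteq X$ between $A$ and $B$ with $asInd(C)\le n-1$ ($C$ with the subspace coarse proximity structure); $asInd(X)=n$ if $n\ge-1$ is the smallest integer with $asInd(X)\le n$; $asInd(X)=\infty$ if there is no such integer. *)

(* Defs.v *)
From HB Require Import structures.
From mathcomp Require Import all_boot all_order all_algebra.
From mathcomp Require Import all_classical all_reals all_analysis.

Set Implicit Arguments.
Unset Strict Implicit.
Unset Printing Implicit Defensive.

Import Order.TTheory GRing.Theory Num.Theory.

Local Open Scope classical_set_scope.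

Definition bornology (T : Type) (B : set (set T)) : Prop :=
  [/\ forall x : T, B [set x],
      forall D E : set T, E `<=` D -> B D -> B E
    & forall D E : set T, B D -> B E -> B (D `|` E)].

Definition coarse_proximity (T : Type) (B : set (set T))
    (b : set T -> set T -> Prop) : Prop :=
  [/\ forall A C, b A C -> b C A,
      forall A C, b A C -> ~ B A /\ ~ B C,
      forall A C, ~ B (A `&` C) -> b A C,
      forall A C D, b (A `|` C) D <-> b A D \/ b C D
    & forall A C, ~ b A C -> exists E, ~ b A E /\ ~ b (~` E) C].

Record coarseProximityType := CoarseProximityType {
  cp_sort :> Type;
  bounded_sub : set (set cp_sort);
  cprox : set cp_sort -> set cp_sort -> Prop;
  bounded_subP : bornology bounded_sub;
  cproxP : coarse_proximity bounded_sub cprox }.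

Arguments bounded_sub : clear implicits.

Section CoarseProximityFacts.
Variable X : coarseProximityType.
Implicit Types A C D E : set X.

Lemma cproxS A A' C C' : A `<=` A' -> C `<=` C' -> cprox A C -> cprox A' C'.
Proof.
have [sym _ _ un _] := cproxP X.
move=> /setUidPr sA /setUidPr sC AC.
have A'C : cprox A' C by rewrite -sA; apply/un; left.
by apply: (sym); rewrite -sC; apply/un; left; apply: sym.
Qed.

Lemma cprox_bounded A C : cprox A C -> ~ bounded_sub X A.
Proof. by have [_ bd _ _ _] := cproxP X => /bd[]. Qed.

End CoarseProximityFacts.

Section Subspace.
Variables (X : coarseProximityType) (Y : set X).

(* The subset [set_val @^-1` B] of the type [Y] is the subset [B `&` Y]. *)
Definition sub_bounded : set (set Y) :=
  [set set_val @^-1` B | B in bounded_sub X].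

Definition sub_cprox (A C : set Y) : Prop :=
  cprox (set_val @` A : set X) (set_val @` C : set X).

Lemma sub_boundedE (A : set Y) :
  sub_bounded A <-> bounded_sub X (set_val @` A).
Proof.
have [_ sb _] := bounded_subP X; split.
  by move=> [B bB <-]; apply: sb bB => _ [x Bx <-].
move=> bA; exists (set_val @` A) => //.
by apply/seteqP; split=> [x [y Ay /val_inj <-]|x Ax] //=; exists x.
Qed.

Lemma sub_bornology : bornology sub_bounded.
Proof.
have [b1 sb bU] := bounded_subP X; split.
- by move=> x; apply/sub_boundedE; rewrite image_set1.
- move=> D E ED /sub_boundedE bD; apply/sub_boundedE.
  by apply: sb bD; apply: image_subset.
- move=> D E /sub_boundedE bD /sub_boundedE bE; apply/sub_boundedE.
  by rewrite image_setU; apply: bU.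
Qed.

Lemma sub_coarse_proximity : coarse_proximity sub_bounded sub_cprox.
Proof.
have [_ sb _] := bounded_subP X.
have [sym bd cap un ex] := cproxP X; split.
- by move=> A C; apply: sym.
- by move=> A C /bd[nA nC]; split=> /sub_boundedE.
- move=> A C nAC; apply: cap => bAC; apply: nAC; apply/sub_boundedE.
  by apply: sb bAC => _ [x [Ax Cx] <-]; split; exists x.
- by move=> A C D; rewrite /sub_cprox image_setU; apply: un.
- move=> A C /ex[E [AE EC]]; exists (set_val @^-1` E); split.
    by move=> AE'; apply/AE/(cproxS _ _ AE') => // _ [x Ex <-].
  by move=> EC'; apply/EC/(cproxS _ _ EC') => // _ [x Ex <-].
Qed.

Definition subCP : coarseProximityType :=
  CoarseProximityType sub_bornology sub_coarse_proximity.

End Subspace.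

Section Smirnov.
Variable X : coarseProximityType.
Implicit Types A C : set X.

Definition delta A C : Prop := A `&` C !=set0 \/ cprox A C.

(* In the third clause [C] ranges over all subsets of [X], so that there is
   no cluster at all when [X] is empty. *)
Definition is_prox_cluster (s : set (set X)) : Prop :=
  [/\ forall A, s A -> A !=set0,
      forall A C, s A -> s C -> delta A C,
      forall C, (forall A, s A -> delta C A) -> s C
    & forall A C, s (A `|` C) -> s A \/ s C].

Record smirnov := Smirnov {
  prox_cluster :> set X -> Prop;
  prox_clusterP : is_prox_cluster prox_cluster }.

HB.instance Definition _ := gen_eqMixin smirnov.
HB.instance Definition _ := gen_choiceMixin smirnov.

Definition delta_star (S1 S2 : set smirnov) : Prop :=
  forall A C, (forall s, S1 s -> s A) -> (forall s, S2 s -> s C) -> delta A C.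

Lemma deltaS A A' C C' : A `<=` A' -> C `<=` C' -> delta A C -> delta A' C'.
Proof.
move=> sA sC [[x [Ax Cx]]|AC]; first by left; exists x; split; [exact: sA|exact: sC].
by right; apply: cproxS AC.
Qed.

Lemma smirnov_sub (s : smirnov) A C : A `<=` C -> s A -> s C.
Proof.
have [_ d m _] := prox_clusterP s => AC sA; apply: m => D sD.
exact: deltaS AC (@subset_refl _ D) (d _ _ sA sD).
Qed.

Lemma delta_star1P (s : smirnov) (S : set smirnov) :
  delta_star [set s] S <-> forall C, (forall t, S t -> t C) -> s C.
Proof.
have [_ d m _] := prox_clusterP s; split=> [sS C SC|sS A C sA SC].
  apply: m => A sA.
  have [sym _ _ _ _] := cproxP X.
  have : delta A C by apply: sS => // _ ->.
  by case=> [|/sym]; [rewrite setIC; left|right].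
by apply: d; [exact: sA|exact: sS].
Qed.

Definition smirnov_open (U : set smirnov) : Prop :=
  forall s, U s -> ~ delta_star [set s] (~` U).

Lemma smirnov_openT : smirnov_open setT.
Proof.
move=> s _ /delta_star1P /(_ set0) s0.
have [/(_ set0) ne _ _ _] := prox_clusterP s.
by have [] : exists x : X, set0 x by apply/ne/s0 => t; rewrite setCT.
Qed.

Lemma smirnov_openI : setI_closed smirnov_open.
Proof.
move=> U V oU oV s [Us Vs] /delta_star1P sUV.
apply: (oU s Us); apply/delta_star1P => A UA; apply: contrapT => nsA.
apply: (oV s Vs); apply/delta_star1P => C VC; apply: contrapT => nsC.
have [_ _ _ sU] := prox_clusterP s.
suff /sU[] : s (A `|` C) by [].
apply: sUV => t; rewrite setCI => -[/UA|/VC]; apply: smirnov_sub => x; by [left|right].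
Qed.

Lemma smirnov_open_bigU (I : Type) (f : I -> set smirnov) :
  (forall i, smirnov_open (f i)) -> smirnov_open (\bigcup_i f i).
Proof.
move=> of_ s [i _ fis] /delta_star1P sf.
apply: (of_ i s fis); apply/delta_star1P => C fC; apply: sf => t nft.
by apply: fC => fit; apply: nft; exists i.
Qed.

HB.instance Definition _ := isOpenTopological.Build smirnov
  smirnov_openT smirnov_openI smirnov_open_bigU.

Lemma closure_smirnovE (S : set smirnov) :
  closure S = [set s | delta_star [set s] S].
Proof.
have cl : closed [set s | delta_star [set s] S].
  rewrite -[X in closed X]setCK; apply: open_closedC.
  suff : smirnov_open (~` [set s | delta_star [set s] S]) by [].
  move=> s ns; rewrite setCK => /delta_star1P sS; apply: ns.
  by apply/delta_star1P => C SC; apply: sS => t /delta_star1P; apply.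
apply/seteqP; split.
  rewrite closureE; apply: smallest_sub => // s Ss /=.
  by apply/delta_star1P => C; apply.
move=> s sS D [U [oU Us UD]]; apply: contrapT => nSD.
have oU' : smirnov_open U by [].
apply: (oU' s Us); apply/delta_star1P => C UC.
move/delta_star1P : sS; apply=> t St; apply: UC => Ut.
by apply: nSD; exists t; split=> //; apply: UD.
Qed.

Lemma delta1E (x : X) A : delta [set x] A <-> A x.
Proof.
have [b1 _ _] := bounded_subP X.
split=> [[[y [/= -> //]]|/cprox_bounded[]//]|Ax].
by left; exists x.
Qed.

Lemma point_cluster_subproof (x : X) : is_prox_cluster [set A | delta [set x] A].
Proof.
split=> [A|A C|C|A C] /=.
- by move=> /delta1E Ax; exists x.
- by move=> /delta1E Ax /delta1E Cx; left; exists x.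
- move=> xC; apply/delta1E.
  have [b1 _ _] := bounded_subP X; have [_ bd _ _ _] := cproxP X.
  have : delta C [set x] by apply: xC; apply/delta1E.
  by case=> [[y [Cy /= <- //]]|/bd[_ /(_ (b1 x))]].
- by move=> /delta1E[Ax|Cx]; [left|right]; apply/delta1E.
Qed.

Definition point_cluster (x : X) : smirnov := Smirnov (point_cluster_subproof x).

Lemma closure_point_cluster A :
  closure (point_cluster @` A) = [set s : smirnov | s A].
Proof.
rewrite closure_smirnovE; apply/seteqP; split=> s /=.
  by move/delta_star1P; apply=> _ [x Ax <-]; apply/delta1E.
move=> sA; apply/delta_star1P => C AC; apply: smirnov_sub sA => x Ax.
by apply/delta1E/(AC (point_cluster x)); exists x.
Qed.

Definition boundary_set : set smirnov :=
  [set s | forall B, bounded_sub X B -> ~ s B].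

Definition boundary : topologicalType := boundary_set.

Definition trace A : set boundary :=
  set_val @^-1` closure (point_cluster @` A).

End Smirnov.

Definition separator (T : topologicalType) (A B C : set T) : Prop :=
  exists U V : set T, [/\ open U, open V, U `&` V = set0, ~` C = U `|` V
                        & A `<=` U /\ B `<=` V].

(* [Ind_lt T n] stands for [Ind(T) <= n - 1]: the natural number [n] encodes
   the dimension [n - 1 >= -1]. The same shift is used in [asInd_lt]. *)
Fixpoint Ind_lt (T : topologicalType) (n : nat) {struct n} : Prop :=
  match n with
  | 0 => [set: T] = set0
  | m.+1 => forall A B : set T, closed A -> closed B -> A `&` B = set0 ->
      exists C : set T, separator A B C /\ Ind_lt (set_type C) m
  end.

Definition asymptotic_separator (X : coarseProximityType) (A B C : set X) :=
  separator (trace A) (trace B) (trace C).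

Fixpoint asInd_lt (X : coarseProximityType) (n : nat) {struct n} : Prop :=
  match n with
  | 0 => bounded_sub X setT
  | m.+1 => forall A B : set X, ~ cprox A B ->
      exists C : set X, asymptotic_separator A B C /\ asInd_lt (subCP C) m
  end.

(* The value [n - 1] for the least [n] satisfying [P], and [+oo] if there is
   none. *)
Definition dimension (P : nat -> Prop) : \bar int :=
  match pselect (exists n, `[< P n >]) with
  | left exP => ((ex_minn exP)%:Z - 1)%:E
  | right _ => +oo%E
  end.

Definition Ind (T : topologicalType) : \bar int := dimension (Ind_lt T).

Definition asInd (X : coarseProximityType) : \bar int := dimension (asInd_lt X).

(* Main.v *)
Require Import Defs.
From mathcomp Require Import all_boot all_order all_algebra.
From mathcomp Require Import all_classical all_reals all_analysis.

(** The inequality reduces to [asInd_lt X n -> Ind_lt (boundary X) n], proved by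
induction on [n] for all [X] at once ([asInd_lt_Ind_lt]). Given disjoint closed
sets [A] and [B] of the boundary, one finds subsets [A0] and [B0] of [X] that
are not close and whose traces contain [A] and [B] ([boundary_separated]). An
asymptotic separator [C] between [A0] and [B0] has a trace that separates the
two larger traces, hence also [A] from [B]. The induction hypothesis bounds the
dimension of the boundary of the subspace [C]; that boundary is homeomorphic to
the trace of [C] ([boundary_subCP]), and [Ind_lt] is a homeomorphism invariant
([Ind_lt_homeo]).

Both geometric ingredients need clusters to be built. The common tool is
[near_all_cluster]: a prime family [G] of pairwise near sets determines the
cluster of all sets that are near every member of [G]. Applied to an
ultrafilter, it yields the compactness that turns disjoint closed sets of
clusters into sets that are far for the proximity [delta_star]
([disjoint_closed_not_near]). Applied to the image of a cluster of [C], it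
yields the cluster of [X] that extends it. The strong axiom of the proximity, in
the form of [delta_interpolate], is what makes these constructions work. *)

Set Implicit Arguments.
Unset Strict Implicit.
Unset Printing Implicit Defensive.

Local Open Scope classical_set_scope.

(** * Dimension functions *)

Lemma le_dimension (P Q : nat -> Prop) :
  (forall n, Q n -> P n) -> (dimension P <= dimension Q)%E.
Proof.
move=> QP; rewrite /dimension.
case: (pselect (exists n, `[< Q n >])) => [exQ|_]; last exact: leey.
have exP : exists n, `[< P n >].
  by have [n /asboolP Qn] := exQ; exists n; apply/asboolP/QP.
case: pselect => [exP'|//].
rewrite lee_fin Num.Theory.lerD2r lez_nat.
case: (ex_minnP exP') => p _ pmin; case: (ex_minnP exQ) => q /asboolP Qq _.
by apply: pmin; apply/asboolP/QP.
Qed.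

(** With the empty set as separator at each stage. It disposes of the case of an
empty [X], where the empty set may be unbounded and hence close to itself. *)
Lemma Ind_lt_empty (T : topologicalType) n : [set: T] = set0 -> Ind_lt T n.
Proof.
elim: n T => [//|n IHn] T T0 A B _ _ _; exists set0; split; last first.
  by apply: IHn; rewrite -subset0 => y _; case: (set_valP y).
have E0 (D : set T) : D = set0 by rewrite -subset0 -T0.
exists set0, set0; split; [exact: open0|exact: open0|exact: setI0| |].
  by rewrite setU0; apply: E0.
by rewrite (E0 A) (E0 B); split.
Qed.

Definition homeomorphic (S T : topologicalType) : Prop :=
  exists (f : S -> T) (g : T -> S),
    [/\ continuous f, continuous g, cancel f g & cancel g f].

Lemma continuous_to_set_type (S T : topologicalType) (D : set T) (f : S -> D) :
  continuous (set_val \o f) -> continuous f.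
Proof. exact: continuous_comp_initial. Qed.

Lemma set_val_continuous (T : topologicalType) (D : set T) :
  continuous (set_val : D -> T).
Proof. exact: initial_continuous. Qed.

Lemma homeomorphic_preimage (S T : topologicalType) (f : S -> T) (g : T -> S)
    (C : set S) :
  continuous f -> continuous g -> cancel f g -> cancel g f ->
  homeomorphic C (g @^-1` C).
Proof.
move=> cf cg fK gK.
have fC (x : C) : (g @^-1` C) (f (set_val x)).
  by rewrite /preimage /= fK; apply: set_valP.
have gC (y : g @^-1` C) : C (g (set_val y)) by apply: (set_valP y).
exists (fun x => SigSub (mem_set (fC x))), (fun y => SigSub (mem_set (gC y))).
split.
- apply: continuous_to_set_type => x.
  by apply: (@continuous_comp _ _ _ (set_val : C -> S) f);
    [exact: set_val_continuous|exact: cf].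
- apply: continuous_to_set_type => y.
  by apply: (@continuous_comp _ _ _ (set_val : g @^-1` C -> T) g);
    [exact: set_val_continuous|exact: cg].
- by move=> x; apply: val_inj; apply: fK.
- by move=> y; apply: val_inj; apply: gK.
Qed.

Lemma separator_preimage (S T : topologicalType) (f : S -> T) (g : T -> S)
    (A B : set T) (C : set S) :
  continuous g -> cancel g f ->
  separator (f @^-1` A) (f @^-1` B) C -> separator A B (g @^-1` C).
Proof.
move=> /continuousP cg gK [U [V [oU oV UV CUV [AU BV]]]].
exists (g @^-1` U), (g @^-1` V); split; [exact: cg|exact: cg| | |split].
- by rewrite -preimage_setI UV preimage_set0.
- by rewrite preimage_setC CUV preimage_setU.
- by move=> y Ay; apply: AU; rewrite /preimage /= gK.
- by move=> y By; apply: BV; rewrite /preimage /= gK.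
Qed.

(** Closed sets are pulled back along [f] and separators along [g]; the latter
homeomorphism restricts to the separators, which lets the induction proceed. *)
Lemma Ind_lt_homeo n (S T : topologicalType) :
  homeomorphic S T -> Ind_lt S n -> Ind_lt T n.
Proof.
elim: n S T => [|n IHn] S T [f [g [cf cg fK gK]]] /=.
  move=> S0; rewrite -subset0 => y _.
  by have : [set: S] (g y) by []; rewrite S0.
move=> IS A B cA cB AB0.
have [||| C [sC IC]] := IS (f @^-1` A) (f @^-1` B).
- by move/continuous_closedP: cf; apply.
- by move/continuous_closedP: cf; apply.
- by rewrite -preimage_setI AB0 preimage_set0.
exists (g @^-1` C); split; first exact: separator_preimage sC.
by apply: IHn IC; apply: homeomorphic_preimage cf cg fK gK.
Qed.

Lemma separatorS (T : topologicalType) (A A' B B' C : set T) :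
  A `<=` A' -> B `<=` B' -> separator A' B' C -> separator A B C.
Proof.
move=> AA' BB' [U [V [oU oV UV CUV [AU BV]]]].
by exists U, V; split=> //; split; [exact: subset_trans AU|exact: subset_trans BV].
Qed.

(** * Clusters of the discrete extension *)

Section Clusters.
Variable X : coarseProximityType.
Implicit Types (A C D E : set X) (s t : smirnov X).

Lemma delta_sym A C : delta A C -> delta C A.
Proof.
have [sym _ _ _ _] := cproxP X.
by case=> [|/sym]; [rewrite setIC; left|right].
Qed.

Lemma deltaUl A C D : delta (A `|` C) D -> delta A D \/ delta C D.
Proof.
have [_ _ _ bU _] := cproxP X.
case=> [[x [[Ax|Cx] Dx]]|/bU[AD|CD]].
- by left; left; exists x.
- by right; left; exists x.
- by left; right.
- by right; right.
Qed.

Lemma not_delta_sub A E : ~ delta A (~` E) -> A `<=` E.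
Proof.
by move=> nAE x Ax; apply: contrapT => nEx; apply: nAE; left; exists x.
Qed.

Lemma delta_nonempty (x : X) A C : delta A C -> A !=set0.
Proof.
move=> dAC; apply/set0P/eqP => A0; subst A; case: dAC => [[y []//]|/cprox_bounded].
by have [b1 bS _] := bounded_subP X; apply; apply: bS (b1 x).
Qed.

(** The strong axiom passes from [cprox] to [delta]: the set [E] provided for
[cprox] is enlarged by [C] and deprived of [A], so that it misses [A] and its
complement misses [C]; neither change creates closeness, as [A] and [C] are
not close. *)
Lemma delta_interpolate A C :
  ~ delta A C -> exists E, ~ delta A E /\ ~ delta (~` E) C.
Proof.
have [sym _ _ bU ex] := cproxP X.
move=> nAC.
have /ex[E [nAE nEC]] : ~ cprox A C by move=> dAC; apply: nAC; right.
have dAC x : A x -> C x -> False by move=> Ax Cx; apply: nAC; left; exists x.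
exists ((E `|` C) `\` A); split => -[].
- by move=> [x [Ax [_ /(_ Ax)]]].
- move=> h; have /sym/bU[] : cprox A (E `|` C) by apply: cproxS h => // x [].
    by move/sym.
  by move/sym => dAC'; apply: nAC; right.
- move=> [x [/not_andP[nEC' Cx|/contrapT Ax Cx]]]; last exact: dAC Ax Cx.
  by apply: nEC'; right.
- move=> h; have /bU[|dAC'] : cprox (~` E `|` A) C.
  + apply: cproxS h => // x /not_andP[nEC'|/contrapT Ax]; last by right.
    by left=> Ex; apply: nEC'; left.
  + exact: nEC.
  + by apply: nAC; right.
Qed.

Lemma smirnov_ext s t : (forall A, s A <-> t A) -> s = t.
Proof.
case: s t => [s sP] [t tP] /= st.
have E : s = t by apply/funext => A; apply/propext.
by subst t; congr Smirnov; apply: Prop_irrelevance.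
Qed.

Lemma cluster_nonempty s A : s A -> A !=set0.
Proof. by have [ne _ _ _] := prox_clusterP s; apply: ne. Qed.

Lemma cluster_delta s A C : s A -> s C -> delta A C.
Proof. by have [_ d _ _] := prox_clusterP s; apply: d. Qed.

Lemma cluster_setU s A C : s (A `|` C) -> s A \/ s C.
Proof. by have [_ _ _ u] := prox_clusterP s; apply: u. Qed.

Lemma cluster_setT s : s setT.
Proof.
have [ne _ m _] := prox_clusterP s; apply: m => A /ne[x Ax].
by left; exists x.
Qed.

Lemma cluster_not_setC s A : ~ s A -> s (~` A).
Proof.
move=> nsA; have : s (A `|` ~` A) by rewrite setUv; apply: cluster_setT.
by case/cluster_setU.
Qed.

(** A cluster that contains [C] is determined by its members inside [C]. If [A]
were far from a member [D], interpolate by [E]: of the two pieces of [C], the one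
outside [E] is far from [D], hence is not a member, and the one inside [E] is far
from [A], hence is not a member either. *)
Lemma cluster_restrict s C A :
  s C -> (forall D, D `<=` C -> s D -> delta A D) -> s A.
Proof.
move=> sC dAC; have [_ _ m _] := prox_clusterP s; apply: m => D sD.
apply: contrapT => /delta_interpolate[E [nAE nED]].
have : s ((C `&` E) `|` (C `\` E)) by rewrite setUIDK.
case/cluster_setU => [sCE|sCE].
  by apply/nAE/(deltaS (@subset_refl _ A) _ (dAC _ _ sCE)) => [x []|x []].
by apply/nED/(deltaS _ (@subset_refl _ D) (cluster_delta sCE sD)) => x [].
Qed.

(** Ultrafilters, clusters and images of clusters under inclusions are all of
this kind. *)
Definition near_prime (G : set (set X)) : Prop :=
  [/\ G setT, ~ G set0, forall A C, G A -> G C -> delta A C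
    & forall A C, G (A `|` C) -> G A \/ G C].

Definition near_all (G : set (set X)) : set (set X) :=
  [set A | forall D, G D -> delta A D].

(** Members are pairwise near since [E] or its complement lies in [G] for each
interpolating [E]. Primeness: if [A] is far from [D] and [C] from [D'], with [D]
and [D'] in [G], interpolating sets [E] and [E'] satisfy that neither [~` E] nor
[E `\` E'] is in [G]; so [E `&` E'] is in [G], and it is far from [A `|` C]. *)
Lemma near_all_cluster G : near_prime G -> is_prox_cluster (near_all G).
Proof.
move=> [GT G0 Gd GU].
have /set0P[x _] : [set: X] != set0 by apply/eqP => E; apply: G0; rewrite -E.
have GC E : G E \/ G (~` E) by apply: GU; rewrite setUv.
split=> /=.
- by move=> A /(_ _ GT)/(delta_nonempty x).
- move=> A C sA sC; apply: contrapT => /delta_interpolate[E [nAE nEC]].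
  by have [/sA//|/sC/delta_sym] := GC E.
- by move=> C sC D GD; apply: sC => D' GD'; apply: Gd.
- move=> A C sAC; apply: contrapT => /not_orP[].
  move=> /existsNP[D /not_implyP[GD /delta_interpolate[E [nAE nED]]]].
  move=> /existsNP[D' /not_implyP[GD' /delta_interpolate[E' [nCE nED']]]].
  have [GE|GE] := GC E; last exact/nED/Gd.
  have : G ((E `&` E') `|` (E `\` E')) by rewrite setUIDK.
  case/GU => [/sAC/deltaUl[AE|CE]|GEE'].
  + by apply: nAE; apply: deltaS AE => // y [].
  + by apply: nCE; apply: deltaS CE => // y [].
  + by apply: nED'; apply: deltaS (Gd _ _ GEE' GD') => // y [].
Qed.

(** * Disjoint closed sets of clusters *)

(** Closed sets are the intersections of the basic closed sets
[set s | s A]. *)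
Lemma closed_smirnovP (F : set (smirnov X)) s :
  closed F -> (forall A, (forall t, F t -> t A) -> s A) -> F s.
Proof.
move=> cF Fs; suff : closure F s by rewrite -(proj1 (closure_id F) cF).
by rewrite closure_smirnovE; apply/delta_star1P.
Qed.

Lemma closed_member A : closed [set s : smirnov X | s A].
Proof. by rewrite -closure_point_cluster; exact: closed_closure. Qed.

(** Containing no bounded set amounts to containing all complements of bounded
sets, because a bounded set is far from its complement. *)
Lemma closed_boundary : closed (@boundary_set X).
Proof.
have -> : @boundary_set X =
    \bigcap_(B in bounded_sub X) [set s : smirnov X | s (~` B)].
  apply/seteqP; split=> s /= bs B bB; first exact/cluster_not_setC/bs.
  move=> sB; have [[x []//]|/cprox_bounded//] := cluster_delta sB (bs B bB).
apply: closed_bigI => B _; apply: closed_member.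
Qed.

Definition common (F : set (smirnov X)) : set (set X) :=
  [set A | forall s, F s -> s A].

(** The proximal neighbourhoods of the members of [common F]. Unlike
[common F], this family is closed under intersection. *)
Definition common_nbhd (F : set (smirnov X)) : set (set X) :=
  [set E | exists2 A, common F A & ~ delta A (~` E)].

Lemma common_nbhdT (x : X) F : common_nbhd F setT.
Proof.
exists setT => [s _|]; first exact: cluster_setT.
by rewrite setCT => /delta_sym/(delta_nonempty x)[].
Qed.

(** With [D] between [A] and the complement of [E], the set [~` D] belongs to
all clusters of [F] and still has [E] as a proximal neighbourhood. The gain over
[A] is that complements of non-members of a cluster are stable under
intersection, by primeness. *)
Lemma common_nbhdI F E E' :
  common_nbhd F E -> common_nbhd F E' -> common_nbhd F (E `&` E').
Proof.
move=> [A FA /delta_interpolate[D [nAD nDE]]].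
move=> [A' FA' /delta_interpolate[D' [nAD' nDE']]].
exists (~` D `&` ~` D').
  move=> s Fs; rewrite -setCU; apply: cluster_not_setC => /cluster_setU[].
    by move=> /(cluster_delta (FA s Fs)).
  by move=> /(cluster_delta (FA' s Fs)).
rewrite setCI => /delta_sym/deltaUl[] /delta_sym h; [apply: nDE|apply: nDE'].
  by apply: deltaS h => // y [].
by apply: deltaS h => // y [].
Qed.

(** A compactness argument: when [F1] and [F2] are near, the proximal
neighbourhoods of the sets common to [F1] meet those of the sets common to [F2].
The cluster of an ultrafilter containing them all contains everything common to
[F1] and everything common to [F2], so it lies in both closed sets. *)
Lemma disjoint_closed_not_near (x : X) (F1 F2 : set (smirnov X)) :
  closed F1 -> closed F2 -> delta_star F1 F2 -> F1 `&` F2 !=set0.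
Proof.
move=> cF1 cF2 F12.
pose I := [set E : set X * set X | common_nbhd F1 E.1 /\ common_nbhd F2 E.2].
have PF : ProperFilter (filter_from I (fun E : set X * set X => E.1 `&` E.2)).
  apply: filter_from_proper.
    apply: filter_from_filter.
      by exists (setT, setT); split; apply: common_nbhdT.
    move=> [D1 D2] [E1 E2] /= [FD1 FD2] [FE1 FE2].
    exists (D1 `&` E1, D2 `&` E2); first by split; apply: common_nbhdI.
    by move=> y /= [[? ?] [? ?]].
  move=> [E1 E2] /= [[A1 FA1 nE1] [A2 FA2 nE2]].
  apply: contrapT => E12; apply: nE1.
  apply: deltaS (F12 _ _ FA1 FA2) => // y A2y E1y.
  by apply: E12; exists y; split=> //; exact: not_delta_sub nE2 _ A2y.
have [U [UU FU]] := ultraFilterLemma PF.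
have PU : ProperFilter U := ultra_proper.
have npU : near_prime U.
  split.
  - exact: filterT.
  - exact: filter_not_empty.
  - move=> A C UA UC; left; exact: filter_ex (filterI UA UC).
  - move=> A C UAC; have [|UnA] := in_ultra_setVsetC A UU; first by left.
    by right; apply: filterS (filterI UAC UnA) => y [[]].
pose s := Smirnov (near_all_cluster npU).
have N1 E : common_nbhd F1 E -> U E.
  move=> NE; apply: FU; exists (E, setT) => [|y []//].
  by split=> //; apply: common_nbhdT.
have N2 E : common_nbhd F2 E -> U E.
  move=> NE; apply: FU; exists (setT, E) => [|y []//].
  by split=> //; apply: common_nbhdT.
have lim F : closed F -> (forall E, common_nbhd F E -> U E) -> F s.
  move=> cF NF; apply: closed_smirnovP => // A FA D UD; apply: contrapT => nAD.
  (* [~` D] is a proximal neighbourhood of [A], so it meets [D]. *)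
  have UnD : U (~` D) by apply: NF; exists A => //; rewrite setCK.
  by have [y []] := filter_ex (filterI UD UnD).
by exists s; split; apply: lim.
Qed.

Lemma closed_image_boundary (A : set (boundary X)) :
  closed A -> closed (set_val @` A : set (smirnov X)).
Proof.
move=> /closed_openC [V oV VA].
have -> : set_val @` A = ~` V `&` @boundary_set X.
  apply/seteqP; split=> [_ [a Aa <-]|s [nVs bs]].
    split; last exact: set_valP.
    move=> Va; have : (set_val @^-1` V) a by [].
    by rewrite VA; apply.
  exists (SigSub (mem_set bs)) => //; apply: contrapT => nA.
  by move: nA; rewrite -[~ _]/((~` A) _) -VA.
by apply: closedI closed_boundary; apply: open_closedC.
Qed.

Lemma traceE (A : set X) (s : boundary X) : trace A s <-> set_val s A.
Proof. by rewrite /trace /preimage /= closure_point_cluster. Qed.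

Lemma boundary_separated (A B : set (boundary X)) (x : X) :
  closed A -> closed B -> A `&` B = set0 ->
  exists A0 B0 : set X,
    [/\ ~ cprox A0 B0, A `<=` trace A0 & B `<=` trace B0].
Proof.
move=> cA cB AB0; apply: contrapT => nAB.
have := disjoint_closed_not_near x (closed_image_boundary cA)
  (closed_image_boundary cB).
case.
  move=> A0 B0 AA0 BB0; apply: contrapT => nA0B0; apply: nAB; exists A0, B0.
  split=> [AB|s As|s Bs]; first by apply: nA0B0; right.
    by apply/traceE/AA0; exists s.
  by apply/traceE/BB0; exists s.
move=> _ [[a Aa <-] [b Bb /val_inj ba]].
by have : (A `&` B) a; [split=> //; rewrite -ba|rewrite AB0].
Qed.

Lemma continuous_to_smirnov (T : topologicalType) (f : T -> smirnov X) :
  (forall A, closed [set t | f t A]) -> continuous f.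
Proof.
move=> cf; apply/continuous_closedP => F cF.
have -> : f @^-1` F = \bigcap_(A in common F) [set t | f t A].
  apply/seteqP; split=> t /=; first by move=> Ft A; apply.
  by move=> ft; apply: closed_smirnovP cF _ => A; exact: ft.
apply: closed_bigI => A _; exact: cf.
Qed.

End Clusters.

(** * The boundary of a subspace is its trace *)

Section SubspaceBoundary.
Variables (X : coarseProximityType) (C : set X).
Implicit Types (s : smirnov X) (t : smirnov (subCP C)).

Lemma image_preimage_val (D : set X) :
  set_val @` (set_val @^-1` D : set C) = C `&` D.
Proof.
apply/seteqP; split=> [_ [x Dx <-]|x [Cx Dx]]; first by split=> //; exact: set_valP.
by exists (SigSub (mem_set Cx)).
Qed.

Lemma sub_deltaE (A D : set (subCP C)) :
  delta A D <-> delta (set_val @` A : set X) (set_val @` D).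
Proof.
split=> -[h|]; do ?by right.
  by left; have [x [Ax Dx]] := h; exists (set_val x); split; exists x.
by left; have [_ [[x Ax <-] [y Dy /val_inj yx]]] := h; exists x; split=> //; rewrite -yx.
Qed.

(** Only the members inside [C] are kept; this is a cluster when [C] is itself
a member. *)
Definition restrict_cluster s : set (set (subCP C)) :=
  [set A | s (set_val @` A)].

Lemma restrict_clusterP s : s C -> is_prox_cluster (restrict_cluster s).
Proof.
move=> sC; split=> /=.
- by move=> A /cluster_nonempty[_ [x Ax _]]; exists x.
- by move=> A D sA sD; apply/sub_deltaE; apply: cluster_delta sA sD.
- move=> A sA; apply: (cluster_restrict sC) => D DC sD.
  have DE : set_val @` (set_val @^-1` D : set C) = D.
    by rewrite image_preimage_val; apply/setIidPr.
  by rewrite -DE; apply/sub_deltaE/sA; rewrite /restrict_cluster /= DE.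
- by move=> A D; rewrite /restrict_cluster /= image_setU => /cluster_setU.
Qed.

Definition push_cluster t : set (set X) :=
  [set D | t (set_val @^-1` D)].

Lemma push_cluster_near_prime t : near_prime (push_cluster t).
Proof.
split.
- exact: cluster_setT.
- by move=> /cluster_nonempty[].
- move=> A D tA tD; have /sub_deltaE := cluster_delta tA tD.
  by apply: deltaS => _ [x Ax <-].
- by move=> A D /cluster_setU.
Qed.

Definition extend_cluster t : smirnov X :=
  Smirnov (near_all_cluster (push_cluster_near_prime t)).

(** This form exhibits the clusters [t] whose extension contains [A] as an
intersection of basic closed sets, whence the continuity of the extension. *)
Lemma extend_clusterE t (A : set X) :
  extend_cluster t A <->
  forall E, ~ delta A E -> t (set_val @^-1` (~` E)).
Proof.
split=> [tA E nAE|tA D tD].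
  by apply: cluster_not_setC => tE; apply/nAE/tA.
apply: contrapT => /delta_interpolate[E [/tA tE nED]]; apply: nED.
by have [_ _ d _] := push_cluster_near_prime t; apply: d.
Qed.

Lemma extend_clusterT t : extend_cluster t C.
Proof.
move=> D /cluster_nonempty[x Dx]; left; exists (set_val x).
by split=> //; apply: set_valP.
Qed.

Lemma extend_restrict t (A : set (subCP C)) :
  restrict_cluster (extend_cluster t) A <-> t A.
Proof.
split=> [tA|tA].
  have [_ _ m _] := prox_clusterP t; apply: m => D tD.
  apply/sub_deltaE/tA; apply: smirnov_sub tD => x Dx; by exists x.
move=> D tD; have /sub_deltaE := cluster_delta tA tD.
by apply: deltaS => // _ [x Dx <-].
Qed.

Lemma restrict_extend s (sC : s C) (A : set X) :
  extend_cluster (Smirnov (restrict_clusterP sC)) A <-> s A.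
Proof.
split=> [sA|sA D sD].
  apply: (cluster_restrict sC) => D DC sD; apply: sA.
  rewrite /push_cluster /= /restrict_cluster /= image_preimage_val.
  by move/setIidPr: DC => ->.
have sCD : s (set_val @` (set_val @^-1` D : set C)) := sD.
by apply: cluster_delta sA _; apply: smirnov_sub sCD => _ [x Dx <-].
Qed.

(** The complement of a bounded set [B] is in the pushed family, while [B] is far
from it. *)
Lemma extend_cluster_boundary t :
  @boundary_set (subCP C) t -> @boundary_set X (extend_cluster t).
Proof.
move=> bt B bB tB.
have tnB : t (set_val @^-1` (~` B)).
  by apply: cluster_not_setC; apply: bt; exists B.
have [[x []//]|/cprox_bounded//] := tB _ tnB.
Qed.

Lemma restrict_cluster_boundary s (sC : s C) :
  @boundary_set X s ->
  @boundary_set (subCP C) (Smirnov (restrict_clusterP sC)).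
Proof. by move=> bs B /sub_boundedE bB; apply: bs. Qed.

(** Extension and restriction of clusters are mutually inverse, and continuous
because preimages of basic closed sets are closed. *)
Lemma boundary_subCP : homeomorphic (boundary (subCP C)) (trace C).
Proof.
have eP (t : boundary (subCP C)) : @boundary_set X (extend_cluster (set_val t)).
  by apply: extend_cluster_boundary; apply: set_valP.
pose e (t : boundary (subCP C)) : boundary X := SigSub (mem_set (eP t)).
have eC (t : boundary (subCP C)) : trace C (e t) by apply/traceE; apply: extend_clusterT.
have rC (s : trace C) : (set_val (set_val s) : smirnov X) C.
  by apply/traceE; apply: set_valP.
have rP (s : trace C) : @boundary_set _ (Smirnov (restrict_clusterP (rC s))).
  by apply: restrict_cluster_boundary; apply: set_valP.
pose f (t : boundary (subCP C)) : trace C := SigSub (mem_set (eC t)).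
pose g (s : trace C) : boundary (subCP C) := SigSub (mem_set (rP s)).
exists f, g; split.
- do 2!apply: continuous_to_set_type.
  apply: continuous_to_smirnov => A.
  have -> : [set t | (set_val \o (set_val \o f)) t A] =
    \bigcap_(E in [set E | ~ delta A E]) (set_val @^-1`
      [set t : smirnov (subCP C) | t (set_val @^-1` (~` E))]).
    by apply/seteqP; split=> t /= /extend_clusterE.
  apply: closed_bigI => E _.
  have /continuous_closedP := @set_val_continuous _ (@boundary_set (subCP C)).
  by apply; apply: closed_member.
- apply: continuous_to_set_type; apply: continuous_to_smirnov => A.
  have /continuous_closedP c1 := @set_val_continuous _ (trace C).
  have /continuous_closedP c2 := @set_val_continuous _ (@boundary_set X).
  have cA := c1 _ (c2 _ (@closed_member X (set_val @` A))).
  exact: cA.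
- move=> t; do !apply: val_inj => /=; apply: smirnov_ext => A.
  exact: extend_restrict.
- move=> s; do 2!apply: val_inj => /=; apply: smirnov_ext => A.
  exact: restrict_extend.
Qed.

End SubspaceBoundary.

(** * Comparison of the two inductive dimensions *)

Lemma boundary_bounded (X : coarseProximityType) :
  bounded_sub X setT -> [set: boundary X] = set0.
Proof.
move=> bT; rewrite -subset0 => s _.
exact: (set_valP s) bT (cluster_setT _).
Qed.

Lemma asInd_lt_Ind_lt n (X : coarseProximityType) :
  asInd_lt X n -> Ind_lt (boundary X) n.
Proof.
elim: n X => [|n IHn] X; first exact: boundary_bounded.
have [X0 _|/set0P[s _]] := eqVneq [set: boundary X] set0.
  exact: Ind_lt_empty.
have [x _] := cluster_nonempty (cluster_setT (set_val s)).
move=> aX A B cA cB AB0.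
have [A0 [B0 [nAB AA0 BB0]]] := boundary_separated x cA cB AB0.
have [C [sC aC]] := aX A0 B0 nAB.
exists (trace C); split; first exact: separatorS sC.
exact: Ind_lt_homeo (boundary_subCP C) (IHn _ aC).
Qed.

Theorem theorem3p12 (X : coarseProximityType) :
  (Ind (boundary X) <= asInd X)%E.
Proof. by apply: le_dimension => n; apply: asInd_lt_Ind_lt. Qed.
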